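(* Let $\mathcal P$ be a set of formulas and let $\mathcal I$ be a stable set of formulas such that $\mathcal I\cap\mathcal P=\emptyset$ and $\perp\notin\mathcal I$. If $\Gamma$ is a finite multiset of formulas of $\mathcal I$ and $A\in\mathcal I$, then $\Gamma\vdash_{\mathcal P} ;A$ (with empty body) if and only if $\Gamma\vdash_{\mathrm{LJ}} A$.
   Context: Formulas are given by the grammar $F ::= 0 \mid \perp \mid X \mid F\wedge F \mid F\vee F \mid F\rightarrow F$, where $X$ ranges over a set $\mathcal V$ of propositional variables and $0$, $\perp$ are two distinct constants. A set $\mathcal S$ of formulas is stable if for every $c\in\{\wedge,\vee,\rightarrow\}$, $A\,c\,B\in\mathcal S$ implies $A,B\in\mathcal S$. $\mathrm{LJ}$ denotes Gentzen's intuitionistic propositional sequent calculus over formulas built from the variables $\mathcal V$ and the constant $0$ with $\wedge,\vee,\rightarrow$, where $0$ is the absurdity (with the rule $\Gamma,0\vdash C$); $\Gamma\vdash_{\mathrm{LJ}}A$ means the sequent is derivable in LJ. Fix a set $\mathcal P$ of formulas. A $\mathcal P$-sequent is an expression $\Gamma\vdash\Delta;\Pi$ where $\Gamma,\Delta,\Pi$ are finite multisets of formulas, every formula of $\Delta$ (the body) belongs to $\mathcal P$, and $\Pi$ (the stoup) contains at most one formula. The system $\mathrm{ML}_{\mathcal P}$ derives $\mathcal P$-sequents with the following rules (below $C$ denotes a single formula, $\Pi$ a stoup with at most one formula, and all sequents must be $\mathcal P$-sequents): Axiom/cuts: $ax$: $A\vdash ;A$. $cut_1$: from $\Gamma\vdash\Delta;A$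 and $\Gamma',A\vdash\Delta';\Pi$ infer $\Gamma,\Gamma'\vdash\Delta,\Delta';\Pi$. $cut_2$: from $\Gamma\vdash\Delta,A;\Pi$ and $\Gamma',A\vdash\Delta';$ infer $\Gamma,\Gamma'\vdash\Delta,\Delta';\Pi$. Structure: $der$: from $\Gamma\vdash\Delta;A$ with $A\in\mathcal P$ infer $\Gamma\vdash\Delta,A;$. $c_l$: from $\Gamma,A,A\vdash\Delta;\Pi$ infer $\Gamma,A\vdash\Delta;\Pi$. $c_r$: from $\Gamma\vdash\Delta,A,A;\Pi$ infer $\Gamma\vdash\Delta,A;\Pi$. $w_l$: from $\Gamma\vdash\Delta;\Pi$ infer $\Gamma,A\vdash\Delta;\Pi$. $w_r$: from $\Gamma\vdash\Delta;\Pi$ with $A\in\mathcal P$ infer $\Gamma\vdash\Delta,A;\Pi$. Logic: $0$: $\Gamma,0\vdash\Delta;\Pi$ (any $\Delta\subseteq\mathcal P$). $\perp$: $\perp\vdash ;$. $\wedge^1_l$: from $\Gamma,A,B\vdash\Delta;C$ with $A\notin\mathcal P$ and $B\notin\mathcal P$ infer $\Gamma,A\wedge B\vdash\Delta;C$. $\wedge^2_l$: from $\Gamma,A,B\vdash\Delta;$ infer $\Gamma,A\wedge B\vdash\Delta;$. $\wedge^1_r$: from $\Gamma\vdash\Delta;A$ and $\Gamma'\vdash\Delta';B$ infer $\Gamma,\Gamma'\vdash\Delta,\Delta';A\wedge B$. $\wedge^2_r$: from $\Gamma\vdash\Delta,A;$ and $\Gamma'\vdash\Delta',B;$ infer the same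 conclusion. $\wedge^3_r$: from $\Gamma\vdash\Delta;A$ and $\Gamma'\vdash\Delta',B;$ infer the same conclusion. $\wedge^4_r$: from $\Gamma\vdash\Delta,A;$ and $\Gamma'\vdash\Delta';B$ infer the same conclusion. $\vee^1_l$: from $\Gamma,A\vdash\Delta;C$ and $\Gamma,B\vdash\Delta;C$ with $A\notin\mathcal P$ and $B\notin\mathcal P$ infer $\Gamma,A\vee B\vdash\Delta;C$. $\vee^2_l$: from $\Gamma,A\vdash\Delta;$ and $\Gamma,B\vdash\Delta;$ infer $\Gamma,A\vee B\vdash\Delta;$. $\vee^1_r$: from $\Gamma\vdash\Delta;A$ infer $\Gamma\vdash\Delta;A\vee B$. $\vee^2_r$: from $\Gamma\vdash\Delta;B$ infer $\Gamma\vdash\Delta;A\vee B$. $\vee^3_r$: from $\Gamma\vdash\Delta,A;$ infer $\Gamma\vdash\Delta;A\vee B$. $\vee^4_r$: from $\Gamma\vdash\Delta,B;$ infer $\Gamma\vdash\Delta;A\vee B$. $\rightarrow^1_l$: from $\Gamma,B\vdash\Delta;C$ and $\Gamma'\vdash\Delta';A$ with $B\notin\mathcal P$ infer $\Gamma,\Gamma',A\rightarrow B\vdash\Delta,\Delta';C$. $\rightarrow^2_l$: from $\Gamma,B\vdash\Delta;$ and $\Gamma'\vdash\Delta';A$ infer $\Gamma,\Gamma',A\rightarrow B\vdash\Delta,\Delta';$. $\rightarrow^3_l$: from $\Gamma,B\vdash\Delta;$ and $\Gamma'\vdash\Delta',A;\Pi$ infer $\Gamma,\Gamma',A\rightarrow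 B\vdash\Delta,\Delta';\Pi$. $\rightarrow^1_r$: from $\Gamma,A\vdash\Delta;B$ infer $\Gamma\vdash\Delta;A\rightarrow B$. $\rightarrow^2_r$: from $\Gamma,A\vdash\Delta,B;$ infer $\Gamma\vdash\Delta;A\rightarrow B$. One writes $\Gamma\vdash_{\mathcal P}\Delta;\Pi$ when the $\mathcal P$-sequent $\Gamma\vdash\Delta;\Pi$ is derivable in $\mathrm{ML}_{\mathcal P}$. *)

(* Defs.v *)
From Stdlib Require Import List Permutation.
Import ListNotations.

Set Implicit Arguments.

(* [Zero] and [Bot] are the two distinct constants 0 and ⊥. *)
Inductive form (V : Type) : Type :=
| Zero : form V
| Bot : form V
| Var : V -> form V
| And : form V -> form V -> form V
| Or : form V -> form V -> form V
| Imp : form V -> form V -> form V.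

Arguments Zero {V}.
Arguments Bot {V}.

Definition stable (V : Type) (S : form V -> Prop) : Prop :=
  (forall A B, S (And A B) -> S A /\ S B) /\
  (forall A B, S (Or A B) -> S A /\ S B) /\
  (forall A B, S (Imp A B) -> S A /\ S B).

(* Finite multisets are lists up to [Permutation]: in both calculi this is the
   exchange rule. A comma is [++] or [::], with the active formulas first. *)

(* [ML P G D S] is derivability of the P-sequent G ⊢ D; S, where the stoup S is
   [None] (empty) or [Some C]. The membership conditions on [ML_der], [ML_wr]
   and [ML_zero] keep every body inside P, see [ML_body]. *)
Inductive ML (V : Type) (P : form V -> Prop) :
  list (form V) -> list (form V) -> option (form V) -> Prop :=
| ML_exch : forall G G' D D' S,
    Permutation G G' -> Permutation D D' -> ML P G D S -> ML P G' D' S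
| ML_ax : forall A, ML P [A] [] (Some A)
| ML_cut1 : forall G G' D D' A S,
    ML P G D (Some A) -> ML P (A :: G') D' S -> ML P (G ++ G') (D ++ D') S
| ML_cut2 : forall G G' D D' A S,
    ML P G (A :: D) S -> ML P (A :: G') D' None -> ML P (G ++ G') (D ++ D') S
| ML_der : forall G D A,
    P A -> ML P G D (Some A) -> ML P G (A :: D) None
| ML_cl : forall G D A S, ML P (A :: A :: G) D S -> ML P (A :: G) D S
| ML_cr : forall G D A S, ML P G (A :: A :: D) S -> ML P G (A :: D) S
| ML_wl : forall G D A S, ML P G D S -> ML P (A :: G) D S
| ML_wr : forall G D A S, P A -> ML P G D S -> ML P G (A :: D) S
| ML_zero : forall G D S, Forall P D -> ML P (Zero :: G) D S
| ML_bot : ML P [Bot] [] None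
| ML_andl1 : forall G D A B C,
    ~ P A -> ~ P B ->
    ML P (A :: B :: G) D (Some C) -> ML P (And A B :: G) D (Some C)
| ML_andl2 : forall G D A B,
    ML P (A :: B :: G) D None -> ML P (And A B :: G) D None
| ML_andr1 : forall G G' D D' A B,
    ML P G D (Some A) -> ML P G' D' (Some B) ->
    ML P (G ++ G') (D ++ D') (Some (And A B))
| ML_andr2 : forall G G' D D' A B,
    ML P G (A :: D) None -> ML P G' (B :: D') None ->
    ML P (G ++ G') (D ++ D') (Some (And A B))
| ML_andr3 : forall G G' D D' A B,
    ML P G D (Some A) -> ML P G' (B :: D') None ->
    ML P (G ++ G') (D ++ D') (Some (And A B))
| ML_andr4 : forall G G' D D' A B,
    ML P G (A :: D) None -> ML P G' D' (Some B) ->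
    ML P (G ++ G') (D ++ D') (Some (And A B))
| ML_orl1 : forall G D A B C,
    ~ P A -> ~ P B ->
    ML P (A :: G) D (Some C) -> ML P (B :: G) D (Some C) ->
    ML P (Or A B :: G) D (Some C)
| ML_orl2 : forall G D A B,
    ML P (A :: G) D None -> ML P (B :: G) D None -> ML P (Or A B :: G) D None
| ML_orr1 : forall G D A B, ML P G D (Some A) -> ML P G D (Some (Or A B))
| ML_orr2 : forall G D A B, ML P G D (Some B) -> ML P G D (Some (Or A B))
| ML_orr3 : forall G D A B, ML P G (A :: D) None -> ML P G D (Some (Or A B))
| ML_orr4 : forall G D A B, ML P G (B :: D) None -> ML P G D (Some (Or A B))
| ML_impl1 : forall G G' D D' A B C,
    ~ P B ->
    ML P (B :: G) D (Some C) -> ML P G' D' (Some A) ->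
    ML P (Imp A B :: G ++ G') (D ++ D') (Some C)
| ML_impl2 : forall G G' D D' A B,
    ML P (B :: G) D None -> ML P G' D' (Some A) ->
    ML P (Imp A B :: G ++ G') (D ++ D') None
| ML_impl3 : forall G G' D D' A B S,
    ML P (B :: G) D None -> ML P G' (A :: D') S ->
    ML P (Imp A B :: G ++ G') (D ++ D') S
| ML_impr1 : forall G D A B,
    ML P (A :: G) D (Some B) -> ML P G D (Some (Imp A B))
| ML_impr2 : forall G D A B,
    ML P (A :: G) (B :: D) None -> ML P G D (Some (Imp A B)).

Lemma ML_body (V : Type) (P : form V -> Prop) G D S : ML P G D S -> Forall P D.
Proof.
  induction 1;
    repeat match goal with
    | H : Forall _ (_ :: _) |- _ => inversion H; clear H; subst
    end;
    try (apply Forall_app; split); auto.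
  eapply Permutation_Forall; eauto.
Qed.

(* The language of LJ: variables, 0, ∧, ∨, →, but not ⊥. *)
Fixpoint bot_free (V : Type) (A : form V) : Prop :=
  match A with
  | Bot => False
  | Zero | Var _ => True
  | And B C | Or B C | Imp B C => bot_free B /\ bot_free C
  end.

(* Gentzen's LJ (with cut), where negation is replaced by the absurdity 0, so
   that succedents are exactly one formula. [bot_free] is required wherever a
   rule introduces a formula not built from those of its premises, so all
   sequents of a derivation are in the language of LJ, see [LJ_bot_free]. *)
Inductive LJ (V : Type) : list (form V) -> form V -> Prop :=
| LJ_exch : forall G G' C, Permutation G G' -> LJ G C -> LJ G' C
| LJ_ax : forall A, bot_free A -> LJ [A] A
| LJ_cut : forall G G' A C, LJ G A -> LJ (A :: G') C -> LJ (G ++ G') C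
| LJ_cl : forall G A C, LJ (A :: A :: G) C -> LJ (A :: G) C
| LJ_wl : forall G A C, bot_free A -> LJ G C -> LJ (A :: G) C
| LJ_zero : forall G C, Forall (@bot_free V) G -> bot_free C -> LJ (Zero :: G) C
| LJ_andl1 : forall G A B C, bot_free B -> LJ (A :: G) C -> LJ (And A B :: G) C
| LJ_andl2 : forall G A B C, bot_free A -> LJ (B :: G) C -> LJ (And A B :: G) C
| LJ_andr : forall G A B, LJ G A -> LJ G B -> LJ G (And A B)
| LJ_orl : forall G A B C,
    LJ (A :: G) C -> LJ (B :: G) C -> LJ (Or A B :: G) C
| LJ_orr1 : forall G A B, bot_free B -> LJ G A -> LJ G (Or A B)
| LJ_orr2 : forall G A B, bot_free A -> LJ G B -> LJ G (Or A B)
| LJ_impl : forall G G' A B C,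
    LJ G A -> LJ (B :: G') C -> LJ (Imp A B :: G ++ G') C
| LJ_impr : forall G A B, LJ (A :: G) B -> LJ G (Imp A B).

Lemma LJ_bot_free (V : Type) (G : list (form V)) C :
  LJ G C -> Forall (@bot_free V) G /\ bot_free C.
Proof.
  induction 1;
    repeat match goal with
    | H : _ /\ _ |- _ => destruct H
    | H : Forall _ (_ :: _) |- _ => inversion H; clear H; subst
    end;
    split; try apply Forall_cons; try (apply Forall_app; split);
    simpl; auto.
  eapply Permutation_Forall; eauto.
Qed.

(* Main.v *)
Require Import Defs.
From Stdlib Require Import List Permutation.
Import ListNotations.

(** Both calculi are compared with natural deduction [NJ] confined to the
    formulas of I.  As I is stable and disjoint from P, a deduction in [NJ]
    translates rule by rule into LJ and into ML_P.  Conversely, ML_P is sound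
    for a Kripke-style forcing relation whose worlds are the [NJ]-contexts and
    which reads every immediate subformula from P, except the left-hand side
    of an implication, up to double negation (with ⊥ read as 0).  On I the double
    negations disappear and forcing coincides with [NJ]-derivability, so cuts
    on formulas outside I do no harm.  LJ is covered by the same argument,
    because it embeds into ML_P for empty P. *)

(** * Natural deduction within a stable set *)

Inductive NJ {V : Type} (I : form V -> Prop) : list (form V) -> form V -> Prop :=
| NJ_hyp : forall G A, In A G -> NJ I G A
| NJ_zero : forall G C, I C -> NJ I G Zero -> NJ I G C
| NJ_andI : forall G A B, I (And A B) -> NJ I G A -> NJ I G B -> NJ I G (And A B)
| NJ_andE1 : forall G A B, NJ I G (And A B) -> NJ I G A
| NJ_andE2 : forall G A B, NJ I G (And A B) -> NJ I G B
| NJ_orI1 : forall G A B, I (Or A B) -> NJ I G A -> NJ I G (Or A B)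
| NJ_orI2 : forall G A B, I (Or A B) -> NJ I G B -> NJ I G (Or A B)
| NJ_orE : forall G A B C,
    NJ I G (Or A B) -> NJ I (A :: G) C -> NJ I (B :: G) C -> NJ I G C
| NJ_impI : forall G A B, I (Imp A B) -> NJ I (A :: G) B -> NJ I G (Imp A B)
| NJ_impE : forall G A B, NJ I G (Imp A B) -> NJ I G A -> NJ I G B.

Lemma NJ_incl V (I : form V -> Prop) G G' A : incl G G' -> NJ I G A -> NJ I G' A.
Proof.
  intros hincl H; revert G' hincl.
  induction H; intros G' hincl.
  - apply NJ_hyp; auto.
  - apply NJ_zero; auto.
  - apply NJ_andI; auto.
  - eapply NJ_andE1; eauto.
  - eapply NJ_andE2; eauto.
  - apply NJ_orI1; auto.
  - apply NJ_orI2; auto.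
  - eapply NJ_orE; [eauto | apply IHNJ2 | apply IHNJ3];
      apply incl_cons; simpl; auto using incl_tl.
  - apply NJ_impI; [auto | apply IHNJ; apply incl_cons; simpl; auto using incl_tl].
  - eapply NJ_impE; eauto.
Qed.

Section StableFragment.
Context {V : Type} {I : form V -> Prop} (hI : stable I).

Lemma stable_and A B : I (And A B) -> I A /\ I B.
Proof. apply hI. Qed.

Lemma stable_or A B : I (Or A B) -> I A /\ I B.
Proof. apply hI. Qed.

Lemma stable_imp A B : I (Imp A B) -> I A /\ I B.
Proof. apply hI. Qed.

Lemma stable_bot_free A : ~ I Bot -> I A -> bot_free A.
Proof.
  intros hbot; induction A as [| | v | A IHA B IHB | A IHA B IHB | A IHA B IHB];
    simpl; intros hA; auto.
  - apply stable_and in hA; intuition.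
  - apply stable_or in hA; intuition.
  - apply stable_imp in hA; intuition.
Qed.

(** Only introductions and [NJ_zero] demand membership in [I]; stability carries it through the
    eliminations. This supplies the side conditions of the left rules when deductions are
    translated. *)
Lemma NJ_closed G A : Forall I G -> NJ I G A -> I A.
Proof.
  intros hG H; induction H; auto.
  - eapply Forall_forall; eauto.
  - apply IHNJ, stable_and in hG; tauto.
  - apply IHNJ, stable_and in hG; tauto.
  - apply IHNJ2; constructor; auto; apply IHNJ1, stable_or in hG; tauto.
  - apply IHNJ1, stable_imp in hG; tauto.
Qed.

End StableFragment.

(** * Structural rules and cuts with a shared context *)

Section Structural.
Context {V : Type} {P : form V -> Prop}.

(* A relation closed under exchange, contraction and weakening is monotone for
   inclusion of the underlying sets; weakening is restricted to [Q] because of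
   the side condition of [LJ_wl]. *)
Lemma structural_incl (Q : form V -> Prop) (R : list (form V) -> Prop) :
  (forall G G', Permutation G G' -> R G -> R G') ->
  (forall G A, R (A :: A :: G) -> R (A :: G)) ->
  (forall G A, Q A -> R G -> R (A :: G)) ->
  forall G G', Forall Q G' -> incl G G' -> R G -> R G'.
Proof.
  intros hexch hc hw.
  assert (hweak : forall G' G, Forall Q G' -> R G -> R (G' ++ G)).
  { induction G' as [|A G' IH]; intros G hQ h; simpl; auto.
    inversion hQ; auto. }
  assert (hcontr : forall G G', incl G G' -> R (G ++ G') -> R G').
  { induction G as [|A G IH]; intros G' hincl h; auto.
    apply incl_cons_inv in hincl; destruct hincl as [hA hincl].
    apply IH; auto.
    (* The copy of [A] coming from [G] is contracted with an occurrence of [A] in [G']. *)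
    destruct (in_split A G' hA) as (G1 & G2 & ->).
    apply hexch with (A :: (G ++ G1 ++ G2)).
    { rewrite !app_assoc; apply Permutation_middle. }
    apply hc, hexch with (A :: (G ++ G1 ++ A :: G2)); auto.
    constructor; rewrite !app_assoc; symmetry; apply Permutation_middle. }
  intros G G' hQ hincl h.
  apply hcontr with G; auto.
  eapply hexch; [apply Permutation_app_comm | auto].
Qed.

Lemma ML_incl G G' D S : incl G G' -> ML P G D S -> ML P G' D S.
Proof.
  apply structural_incl with (Q := fun _ => True) (R := fun G => ML P G D S).
  - intros; eapply ML_exch; eauto.
  - intros; apply ML_cl; auto.
  - intros; apply ML_wl; auto.
  - apply Forall_forall; auto.
Qed.

Lemma LJ_incl G G' (C : form V) :
  Forall (@bot_free V) G' -> incl G G' -> LJ G C -> LJ G' C.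
Proof.
  apply structural_incl with (R := fun G => LJ G C).
  - intros; eapply LJ_exch; eauto.
  - intros; apply LJ_cl; auto.
  - intros; apply LJ_wl; auto.
Qed.

Lemma ML_cut_shared G A C :
  ML P G [] (Some A) -> ML P (A :: G) [] (Some C) -> ML P G [] (Some C).
Proof.
  intros h1 h2; apply ML_incl with (G ++ G); [apply incl_app; apply incl_refl |].
  exact (ML_cut1 h1 h2).
Qed.

Lemma LJ_cut_shared G (A C : form V) : LJ G A -> LJ (A :: G) C -> LJ G C.
Proof.
  intros h1 h2; apply LJ_incl with (G ++ G).
  - exact (proj1 (LJ_bot_free h1)).
  - apply incl_app; apply incl_refl.
  - exact (LJ_cut h1 h2).
Qed.

End Structural.

(** * Translations between the calculi *)

(** With [P] empty every side condition [~ P A] holds, so each rule of LJ is simulated with the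
    stoup alone; weakening and contraction bridge the differences in contexts. *)
Lemma LJ_ML_empty V G (A : form V) : LJ G A -> ML (fun _ => False) G [] (Some A).
Proof.
  induction 1.
  - eapply ML_exch; eauto.
  - apply ML_ax.
  - exact (ML_cut1 IHLJ1 IHLJ2).
  - apply ML_cl; auto.
  - apply ML_wl; auto.
  - apply ML_zero; auto.
  - apply ML_andl1; auto.
    eapply ML_incl; [|eassumption]; intros X; simpl; tauto.
  - apply ML_andl1; auto; apply ML_wl; auto.
  - apply ML_incl with (G ++ G); [apply incl_app; apply incl_refl |].
    exact (ML_andr1 IHLJ1 IHLJ2).
  - apply ML_orl1; auto.
  - apply ML_orr1; auto.
  - apply ML_orr2; auto.
  - apply ML_incl with (Imp A B :: G' ++ G).
    + intros X; simpl; rewrite !in_app_iff; tauto.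
    + exact (ML_impl1 (fun f => f) IHLJ2 IHLJ1).
  - apply ML_impr1; auto.
Qed.

(** Each elimination becomes a cut against a left rule with a nonempty stoup, whose side conditions
    hold because the formulas involved lie in [I], hence outside [P]. *)
Lemma NJ_ML V (P I : form V -> Prop) (hI : stable I)
  (hIP : forall B, ~ (I B /\ P B)) G A :
  Forall I G -> NJ I G A -> ML P G [] (Some A).
Proof.
  assert (hP : forall B, I B -> ~ P B) by firstorder.
  intros hG H; revert hG; induction H; intros hG.
  - apply ML_incl with [A]; [intros X [<-|[]]; auto | apply ML_ax].
  - apply ML_cut_shared with Zero; auto; apply ML_zero; auto.
  - apply ML_incl with (G ++ G); [apply incl_app; apply incl_refl |].
    exact (ML_andr1 (IHNJ1 hG) (IHNJ2 hG)).
  - destruct (stable_and hI _ _ (NJ_closed hI _ _ hG H)).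
    apply ML_cut_shared with (And A B); auto; apply ML_andl1; auto.
    apply ML_incl with [A]; [intros X; simpl; tauto | apply ML_ax].
  - destruct (stable_and hI _ _ (NJ_closed hI _ _ hG H)).
    apply ML_cut_shared with (And A B); auto; apply ML_andl1; auto.
    apply ML_incl with [B]; [intros X; simpl; tauto | apply ML_ax].
  - apply ML_orr1; auto.
  - apply ML_orr2; auto.
  - destruct (stable_or hI _ _ (NJ_closed hI _ _ hG H)).
    apply ML_cut_shared with (Or A B); auto; apply ML_orl1; auto.
  - destruct (stable_imp hI _ _ H).
    apply ML_impr1; auto.
  - destruct (stable_imp hI _ _ (NJ_closed hI _ _ hG H)).
    apply ML_cut_shared with (Imp A B); auto.
    refine (@ML_impl1 _ P [] G [] [] A B B _ (ML_ax P B) _); auto.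
Qed.

Lemma NJ_LJ V (I : form V -> Prop) (hI : stable I) (hbot : ~ I Bot) G A :
  Forall I G -> NJ I G A -> LJ G A.
Proof.
  assert (hbf : forall B, I B -> bot_free B) by (intros; eapply stable_bot_free; eauto).
  intros hG H; revert hG; induction H; intros hG.
  all: assert (hG' := Forall_impl _ hbf hG).
  - apply LJ_incl with [A]; auto; [intros X [<-|[]]; auto |].
    apply LJ_ax; eapply Forall_forall; eauto.
  - apply LJ_cut_shared with Zero; auto; apply LJ_zero; auto.
  - apply LJ_andr; auto.
  - destruct (hbf _ (NJ_closed hI _ _ hG H)).
    apply LJ_cut_shared with (And A B); auto; apply LJ_andl1; auto.
    apply LJ_incl with [A]; auto; [intros X; simpl; tauto | apply LJ_ax; auto].
  - destruct (hbf _ (NJ_closed hI _ _ hG H)).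
    apply LJ_cut_shared with (And A B); auto; apply LJ_andl2; auto.
    apply LJ_incl with [B]; auto; [intros X; simpl; tauto | apply LJ_ax; auto].
  - apply LJ_orr1; auto; apply hbf in H; apply H.
  - apply LJ_orr2; auto; apply hbf in H; apply H.
  - destruct (stable_or hI _ _ (NJ_closed hI _ _ hG H)).
    apply LJ_cut_shared with (Or A B); auto; apply LJ_orl; auto.
  - destruct (stable_imp hI _ _ H).
    apply LJ_impr; auto.
  - destruct (hbf _ (NJ_closed hI _ _ hG H)).
    apply LJ_cut_shared with (Imp A B); auto.
    apply LJ_incl with (Imp A B :: G ++ []).
    + repeat constructor; auto.
    + rewrite app_nil_r; apply incl_refl.
    + apply LJ_impl; auto; apply LJ_ax; auto.
Qed.

(** * The forcing model on contexts *)

Section Forcing.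
Variables (V : Type) (P I : form V -> Prop).

Definition extends (G G' : list (form V)) : Prop := incl G G' /\ Forall I G'.

(** Worlds may be absurd, as in fallible Kripke models. All conclusions in [I] are quantified over
    because [Zero] itself may lie outside [I]. *)
Definition absurd_at (G : list (form V)) : Prop := forall C, I C -> NJ I G C.

Definition neg_at (phi : list (form V) -> Prop) (G : list (form V)) : Prop :=
  forall G', extends G G' -> phi G' -> absurd_at G'.

(* Reads "phi, up to double negation if A is in P", in a form that does not
   require deciding membership in P. *)
Definition relax (A : form V) (phi : list (form V) -> Prop) (G : list (form V)) : Prop :=
  neg_at (neg_at phi) G /\ (~ P A -> phi G).

(* Disjunction is forced through its elimination rule, with conclusions in I;
   this is what makes completeness on I provable without prime contexts. *)
Fixpoint force (A : form V) (G : list (form V)) : Prop :=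
  match A with
  | Zero | Bot => absurd_at G
  | Var v => I (Var v) -> NJ I G (Var v)
  | And A B => relax A (force A) G /\ relax B (force B) G
  | Or A B =>
      forall C G', I C -> extends G G' ->
        (forall G'', extends G' G'' -> relax A (force A) G'' -> NJ I G'' C) ->
        (forall G'', extends G' G'' -> relax B (force B) G'' -> NJ I G'' C) ->
        NJ I G' C
  | Imp A B => forall G', extends G G' -> force A G' -> relax B (force B) G'
  end.

Lemma extends_refl G : Forall I G -> extends G G.
Proof. split; auto using incl_refl. Qed.

Lemma extends_trans G G' G'' : extends G G' -> extends G' G'' -> extends G G''.
Proof. intros [] []; split; eauto using incl_tran. Qed.

Lemma extends_cons G A : Forall I G -> I A -> extends G (A :: G).
Proof. split; auto using incl_tl, incl_refl. Qed.

Definition monotone (phi : list (form V) -> Prop) : Prop :=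
  forall G G', extends G G' -> phi G -> phi G'.

Lemma absurd_at_monotone : monotone absurd_at.
Proof. intros G G' [] h C hC; eapply NJ_incl; eauto. Qed.

Lemma neg_at_monotone phi : monotone (neg_at phi).
Proof. intros G G' hG h G'' hG'; apply h; eapply extends_trans; eauto. Qed.

Lemma relax_monotone A phi : monotone phi -> monotone (relax A phi).
Proof.
  intros hphi G G' hG [h1 h2]; split.
  - eapply neg_at_monotone; eauto.
  - intros; eapply hphi; eauto.
Qed.

Lemma force_monotone A : monotone (force A).
Proof.
  induction A as [| | v | A IHA B IHB | A IHA B IHB | A IHA B IHB];
    intros G G' hG; simpl.
  - apply absurd_at_monotone; auto.
  - apply absurd_at_monotone; auto.
  - destruct hG; eauto using NJ_incl.
  - intros [h1 h2]; split; eapply relax_monotone; eauto.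
  - intros h C G'' hC hG'; apply h; auto; eapply extends_trans; eauto.
  - intros h G'' hG'; apply h; eapply extends_trans; eauto.
Qed.

Lemma relax_intro A phi G : Forall I G -> monotone phi -> phi G -> relax A phi G.
Proof.
  intros hG hphi h; split; auto.
  intros G' hG' hneg; apply hneg.
  - apply extends_refl; apply hG'.
  - eapply hphi; eauto.
Qed.

Lemma relax_intro_neg A phi G : P A -> neg_at (neg_at phi) G -> relax A phi G.
Proof. split; tauto. Qed.

(** Towards absurdity a double negation can be stripped whether or not [A] is in [P]. This is what
    validates the left rules whose premise has an empty stoup. *)
Lemma relax_absurd A phi G :
  Forall I G -> relax A phi G -> neg_at phi G -> absurd_at G.
Proof. intros hG [h _]; apply h; apply extends_refl; auto. Qed.

(* The closure property needed to eliminate a forced disjunction (or a forced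
   absurdity) into [phi]. *)
Definition closed (phi : list (form V) -> Prop) : Prop :=
  forall G, Forall I G ->
    (forall C G', I C -> extends G G' ->
       (forall G'', extends G' G'' -> phi G'' -> NJ I G'' C) -> NJ I G' C) ->
    phi G.

Lemma absurd_at_closed : closed absurd_at.
Proof.
  intros G hG h C hC; apply h; auto using extends_refl.
Qed.

Lemma neg_at_closed phi : monotone phi -> closed (neg_at phi).
Proof.
  intros hphi G hG h G' hG' h' C hC.
  apply h; auto.
  intros G'' hG'' hneg; apply hneg; auto.
  - apply extends_refl; apply hG''.
  - eapply hphi; eauto.
Qed.

(** A continuation for [psi] is also one for [phi]; closure of a compound thus reduces to closure of
    its components. *)
Lemma closed_impl_inv (phi psi : list (form V) -> Prop) G :
  (forall G', extends G G' -> phi G' -> psi G') ->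
  (forall C G', I C -> extends G G' ->
     (forall G'', extends G' G'' -> phi G'' -> NJ I G'' C) -> NJ I G' C) ->
  forall C G', I C -> extends G G' ->
     (forall G'', extends G' G'' -> psi G'' -> NJ I G'' C) -> NJ I G' C.
Proof.
  intros himp h C G' hC hG' hk; apply h; auto.
  intros G'' hG'' hphi; apply hk; auto; apply himp; auto.
  eapply extends_trans; eauto.
Qed.

Lemma relax_closed A phi : closed phi -> closed (relax A phi).
Proof.
  intros hphi G hG h; split.
  - apply neg_at_closed; auto using neg_at_monotone.
    eapply closed_impl_inv; [|exact h]; intros G' _ h'; apply h'.
  - intros hA; apply hphi; auto.
    eapply closed_impl_inv; [|exact h]; intros G' _ h'; apply h'; auto.
Qed.

(** Induction on [A]: a variable is its own conclusion [C], and the other cases push the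
    continuation inside the connective. *)
Lemma force_closed A : closed (force A).
Proof.
  induction A as [| | v | A IHA B IHB | A IHA B IHB | A IHA B IHB];
    intros G hG h; simpl in *.
  - apply absurd_at_closed; auto.
  - apply absurd_at_closed; auto.
  - intros hv; apply h; auto using extends_refl.
  - split; apply relax_closed; auto;
      (eapply closed_impl_inv; [|exact h]); intros G' _ h'; apply h'.
  - intros C G' hC hG' h1 h2; apply h; auto.
    intros G'' hG'' h'; apply h'; auto.
    + apply extends_refl; apply hG''.
    + intros; apply h1; auto; eapply extends_trans; eauto.
    + intros; apply h2; auto; eapply extends_trans; eauto.
  - intros G' hG' hA; apply relax_closed; auto; [apply hG'|].
    intros C G'' hC hG'' hk; apply h; auto.
    + eapply extends_trans; eauto.
    + intros G3 hG3 h'; apply hk; auto; apply h'.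
      * apply extends_refl; apply hG3.
      * eapply force_monotone; [|exact hA]; eapply extends_trans; eauto.
Qed.

(** Ex falso: at an absurd world the premise of closure holds without calling its continuation. *)
Lemma absurd_force A G : Forall I G -> absurd_at G -> force A G.
Proof.
  intros hG h; apply force_closed; auto.
  intros C G' hC hG' _; eapply absurd_at_monotone; eauto.
Qed.

(** * Soundness of ML for forcing *)

Definition force_stoup (S : option (form V)) (G : list (form V)) : Prop :=
  match S with Some C => force C G | None => absurd_at G end.

Definition force_all (Ga : list (form V)) (G : list (form V)) : Prop :=
  Forall (fun X => force X G) Ga.

(** Body formulas act as refuted hypotheses, so deriving one in the body only yields its double
    negation. *)
Definition refute_all (D : list (form V)) (G : list (form V)) : Prop :=
  Forall (fun X => neg_at (force X) G) D.

Lemma force_all_monotone Ga : monotone (force_all Ga).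
Proof.
  intros G G' hG; apply Forall_impl; intros X; apply force_monotone; auto.
Qed.

Lemma refute_all_monotone D : monotone (refute_all D).
Proof.
  intros G G' hG; apply Forall_impl; intros X; apply neg_at_monotone; auto.
Qed.

Definition valid (Ga D : list (form V)) (S : option (form V)) : Prop :=
  forall G, Forall I G -> force_all Ga G -> refute_all D G -> force_stoup S G.

Lemma valid_neg Ga D A G :
  valid (A :: Ga) D None -> force_all Ga G -> refute_all D G -> neg_at (force A) G.
Proof.
  intros h hGa hD G' hG' hA; apply (h G').
  - apply hG'.
  - constructor; auto; eapply force_all_monotone; eauto.
  - eapply refute_all_monotone; eauto.
Qed.

Lemma valid_neg_neg Ga D A G :
  valid Ga (A :: D) None -> force_all Ga G -> refute_all D G ->
  neg_at (neg_at (force A)) G.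
Proof.
  intros h hGa hD G' hG' hA; apply (h G').
  - apply hG'.
  - eapply force_all_monotone; eauto.
  - constructor; auto; eapply refute_all_monotone; eauto.
Qed.

Lemma valid_relax Ga D A G :
  valid Ga D (Some A) -> Forall I G -> force_all Ga G -> refute_all D G ->
  relax A (force A) G.
Proof. intros h hG hGa hD; apply relax_intro; auto using force_monotone; apply h; auto. Qed.

Lemma valid_relax_body Ga D A G :
  P A -> valid Ga (A :: D) None -> force_all Ga G -> refute_all D G ->
  relax A (force A) G.
Proof. intros hA h hGa hD; apply relax_intro_neg; auto; eapply valid_neg_neg; eauto. Qed.

Lemma force_or_intro A B G :
  Forall I G -> relax A (force A) G \/ relax B (force B) G -> force (Or A B) G.
Proof.
  intros hG h C G' hC hG' h1 h2.
  assert (hr : extends G' G') by (apply extends_refl; apply hG').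
  destruct h as [h|h]; [apply h1 | apply h2]; auto;
    exact (relax_monotone _ _ (force_monotone _) _ _ hG' h).
Qed.

(** Induction on the derivation. A premise with its active formula in the stoup gives plain forcing;
    one with it in the body gives a double negation, which [relax] accepts since that formula is in
    [P]. *)
Lemma ML_valid Ga D S : ML P Ga D S -> valid Ga D S.
Proof.
  unfold valid, force_all, refute_all.
  induction 1 as
    [Ga Ga' D D' S hp hp' _ IH | A | Ga Ga' D D' A S _ IH1 _ IH2
    | Ga Ga' D D' A S _ IH1 _ IH2 | Ga D A hPA _ IH | Ga D A S _ IH | Ga D A S _ IH
    | Ga D A S _ IH | Ga D A S hPA _ IH | Ga D S hPD |
    | Ga D A B C hA hB _ IH | Ga D A B _ IH
    | Ga Ga' D D' A B _ IH1 _ IH2 | Ga Ga' D D' A B H1 IH1 H2 IH2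
    | Ga Ga' D D' A B _ IH1 H2 IH2 | Ga Ga' D D' A B H1 IH1 _ IH2
    | Ga D A B C hA hB _ IH1 _ IH2 | Ga D A B _ IH1 _ IH2
    | Ga D A B _ IH | Ga D A B _ IH | Ga D A B H IH | Ga D A B H IH
    | Ga Ga' D D' A B C hB _ IH1 _ IH2 | Ga Ga' D D' A B _ IH1 _ IH2
    | Ga Ga' D D' A B S _ IH1 _ IH2
    | Ga D A B _ IH | Ga D A B H IH];
    intros G hG hGa hD;
    repeat match goal with
    | H : Forall _ (_ :: _) |- _ => inversion H; clear H; subst
    | H : Forall _ (_ ++ _) |- _ => apply Forall_app in H; destruct H
    (* The active body formula is in [P], as [valid_relax_body] requires. *)
    | H : ML P _ (_ :: _) _ |- _ =>
        apply ML_body in H; inversion H; clear H; subst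
    end.
  - apply IH; auto.
    + eapply Permutation_Forall; [symmetry|]; eauto.
    + eapply Permutation_Forall; [symmetry|]; eauto.
  - assumption.
  - apply IH2; auto. constructor; auto. apply IH1; auto.
  (* The right premise of [ML_cut2] refutes the cut formula, which may then join the refuted
     body. *)
  - apply IH1; auto. constructor; auto. eapply valid_neg; [exact IH2 | | ]; eauto.
  - match goal with h : neg_at _ G |- _ => apply h end; auto using extends_refl.
    apply IH; auto.
  - apply IH; auto.
  - apply IH; auto.
  - apply IH; auto.
  - apply IH; auto.
  - destruct S; [apply absurd_force|]; assumption.
  - assumption.
  - match goal with h : force (And A B) G |- _ => destruct h as [[_ h1] [_ h2]] end.
    apply IH; auto.
  - match goal with h : force (And A B) G |- _ => destruct h as [h1 h2] end.
    (* The goal is absurdity, so the two conjuncts are freed of their double negations one after the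
       other. *)
    apply (relax_absurd _ _ _ hG h1); intros G1 hG1 hA.
    assert (hI1 : Forall I G1) by apply hG1.
    apply (relax_monotone _ _ (force_monotone B) _ _ hG1) in h2.
    apply (relax_absurd _ _ _ hI1 h2).
    apply (valid_neg (A :: Ga) D); auto.
    + intros G2 hG2 hGa2 hD2; apply (IH G2); auto.
      inversion hGa2 as [|? ? hB2 hr]; inversion hr; subst; auto.
    + constructor; auto; eapply force_all_monotone; eauto.
    + eapply refute_all_monotone; eauto.
  - split; [eapply valid_relax; [exact IH1 | ..] | eapply valid_relax; [exact IH2 | ..]]; auto.
  - split; [eapply valid_relax_body; [|exact IH1 | ..]
           | eapply valid_relax_body; [|exact IH2 | ..]]; auto.
  - split; [eapply valid_relax; [exact IH1 | ..]
           | eapply valid_relax_body; [|exact IH2 | ..]]; auto.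
  - split; [eapply valid_relax_body; [|exact IH1 | ..]
           | eapply valid_relax; [exact IH2 | ..]]; auto.
  - match goal with h : force (Or A B) G |- _ => rename h into hor end.
    (* A forced disjunction eliminates only into [NJ] conclusions; closure brings the goal
       [force C G] to that form. *)
    apply force_closed; auto; intros C' G' hC' hG' hk.
    apply hor; auto; intros G'' hG'' [_ h]; apply hk; auto;
      assert (hG0 := extends_trans _ _ _ hG' hG'');
      [apply IH1 | apply IH2]; try exact (proj2 hG0);
      try exact (refute_all_monotone _ _ _ hG0 hD);
      constructor; solve [apply h; assumption
                         | exact (force_all_monotone _ _ _ hG0 ltac:(eassumption))].
  - match goal with h : force (Or A B) G |- _ => rename h into hor end.
    intros C hC; apply hor; auto using extends_refl;
      intros G' hG' h; assert (hI' : Forall I G') by apply hG';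
      refine (relax_absurd _ _ _ hI' h _ C hC);
      [eapply valid_neg; [exact IH1 | ..] | eapply valid_neg; [exact IH2 | ..]];
      solve [eapply force_all_monotone; eauto | eapply refute_all_monotone; eauto].
  - apply force_or_intro; auto; left; eapply valid_relax; [exact IH | ..]; auto.
  - apply force_or_intro; auto; right; eapply valid_relax; [exact IH | ..]; auto.
  - apply force_or_intro; auto; left; eapply valid_relax_body; [|exact IH | ..]; auto.
  - apply force_or_intro; auto; right; eapply valid_relax_body; [|exact IH | ..]; auto.
  - match goal with h : force (Imp A B) G |- _ => rename h into himp end.
    apply IH1; auto; constructor; auto.
    apply himp; auto using extends_refl; apply IH2; auto.
  - match goal with h : force (Imp A B) G |- _ => rename h into himp end.
    apply (relax_absurd B (force B)); auto.
    + apply himp; auto using extends_refl; apply IH2; auto.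
    + eapply valid_neg; [exact IH1 | ..]; auto.
  - match goal with h : force (Imp A B) G |- _ => rename h into himp end.
    apply IH2; auto; constructor; auto.
    (* [A] is refuted: forcing it would give a relaxed [B], which the first premise refutes. *)
    intros G' hG' hA; assert (hI' : Forall I G') by apply hG'.
    apply (relax_absurd B (force B)); auto.
    eapply valid_neg; [exact IH1 | ..].
    + eapply force_all_monotone; eauto.
    + eapply refute_all_monotone; eauto.
  - intros G' hG' hA; eapply valid_relax; [exact IH | apply hG' | ..].
    + constructor; auto; eapply force_all_monotone; eauto.
    + eapply refute_all_monotone; eauto.
  - intros G' hG' hA; eapply valid_relax_body; [|exact IH | ..]; auto.
    + constructor; auto; eapply force_all_monotone; eauto.
    + eapply refute_all_monotone; eauto.
Qed.

(** * Completeness on [I] *)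

Hypotheses (hI : stable I) (hIP : forall B, ~ (I B /\ P B)) (hbot : ~ I Bot).

Lemma relax_outside A phi G :
  I A -> Forall I G -> monotone phi -> relax A phi G <-> phi G.
Proof.
  intros hA hG hphi; split.
  - intros [_ h]; apply h; firstorder.
  - apply relax_intro; auto.
Qed.

(** Both directions are proved together because implication uses each on its antecedent;
    disjointness from [P] removes every [relax] on the way. *)
Lemma force_iff_NJ A G : I A -> Forall I G -> force A G <-> NJ I G A.
Proof.
  revert G; induction A as [| | v | A IHA B IHB | A IHA B IHB | A IHA B IHB];
    intros G hA hG; simpl.
  - split; [intros h; apply h; auto | intros h C hC; apply NJ_zero; auto].
  - contradiction.
  - split; auto.
  - destruct (stable_and hI _ _ hA).
    rewrite !relax_outside, IHA, IHB by auto using force_monotone.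
    split; [intros []; apply NJ_andI; auto | intros h; split].
    + eapply NJ_andE1; eauto.
    + eapply NJ_andE2; eauto.
  - destruct (stable_or hI _ _ hA) as [hA1 hB1]; split.
    (* The elimination is instantiated at [C := Or A B], so no disjunct has to be chosen at [G]. *)
    + intros h; apply h; auto using extends_refl; intros G' [_ hG'];
        rewrite relax_outside by auto using force_monotone; intros hf.
      * apply NJ_orI1; auto; apply IHA; auto.
      * apply NJ_orI2; auto; apply IHB; auto.
    + intros h C G' hC [hincl hG'] h1 h2.
      apply NJ_orE with A B; [eapply NJ_incl; eauto | apply h1 | apply h2];
        auto using extends_cons; apply relax_outside; auto using force_monotone;
        [apply IHA | apply IHB]; auto; apply NJ_hyp; simpl; auto.
  - destruct (stable_imp hI _ _ hA) as [hA1 hB1]; split.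
    + intros h; apply NJ_impI; auto; apply IHB; auto.
      apply (proj1 (relax_outside B (force B) (A :: G) hB1 ltac:(auto) (force_monotone B))).
      apply h; auto using extends_cons.
      apply IHA; auto; apply NJ_hyp; simpl; auto.
    + intros h G' [hincl hG'] hf.
      rewrite relax_outside by auto using force_monotone.
      apply IHB; auto; apply NJ_impE with A.
      * eapply NJ_incl; eauto.
      * apply IHA; auto.
Qed.

(** Soundness is evaluated at the world [G] itself, which forces each of its own members by
    [NJ_hyp]. *)
Lemma ML_NJ G A : Forall I G -> I A -> ML P G [] (Some A) -> NJ I G A.
Proof.
  intros hG hA h; apply force_iff_NJ; auto.
  apply (ML_valid _ _ _ h G hG); [|constructor].
  apply Forall_forall; intros X hX.
  apply force_iff_NJ; auto.
  - rewrite Forall_forall in hG; auto.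
  - apply NJ_hyp; auto.
Qed.

End Forcing.

Theorem theorem4p4 (V : Type) (P I : form V -> Prop)
  (hI : stable I) (hIP : forall B, ~ (I B /\ P B)) (hbot : ~ I Bot)
  (G : list (form V)) (A : form V) (hG : Forall I G) (hA : I A) :
  ML P G [] (Some A) <-> LJ G A.
Proof.
  split; intros h.
  - apply NJ_LJ with I; auto; apply ML_NJ with P; auto.
  - apply NJ_ML with I; auto.
    apply ML_NJ with (fun _ => False); auto; [tauto | apply LJ_ML_empty; auto].
Qed.
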